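(* Let $p\ge1$, $L=\lceil(p+1)/2\rceil$, $h>0$, $T>0$. For any $\mathbf v,\mathbf w:[0,T]\times\mathbb T\to\mathbb R^3$ and any $\mathbf u:\mathbb T\to\mathbb C^L$ (differentiable, so that $\partial_x\mathbf u$ is defined), we have, pointwise in $(t,x)$, $$\left\|\exp\left(\sum_{k=1}^p\mathcal Q_h[\mathsf H_k;\mathbf u](x)\right)\mathbf v-\exp\left(\sum_{k=1}^p\mathcal Q_h[\mathsf H_k;\mathbf u](x)\right)\mathbf w\right\|_{\ell^2}=\|\mathbf v-\mathbf w\|_{\ell^2},$$ where $\mathcal Q_h[\mathsf H_k;\mathbf u](x)\in\mathbb R^{3\times3}$ are the interpolatory Magnus quadratures defined in the context.
   Context: $\mathbb T=\mathbb R/(2\pi\mathbb Z)$, $\|\cdot\|_{\ell^2}$ is the Euclidean norm on $\mathbb R^3$. For $a,b\in\mathbb C$ let $$\mathsf A(a,b)=\begin{pmatrix}0&-\mathrm{Im}\,b&\mathrm{Re}\,b\\ \mathrm{Im}\,b&0&-\frac{|a|^2}{2}\\-\mathrm{Re}\,b&\frac{|a|^2}{2}&0\end{pmatrix}.$$ For a matrix function $\mathsf A(\xi)$, $\xi\in[0,h]$, the Magnus terms are $\mathsf H_1(t)=\int_0^t\mathsf A(s)\,ds$ and, for $k\ge2$, $\mathsf H_k(t)=\sum_{j=1}^{k-1}\frac{B_j}{j!}\sum_{k_1+\dots+k_j=k-1,\ k_i\ge1}\int_0^t[\mathsf H_{k_1}(s),[\mathsf H_{k_2}(s),\dots[\mathsf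 H_{k_j}(s),\mathsf A(s)]\dots]]\,ds$, with $B_j$ the Bernoulli numbers ($B_1=-\frac12$) and $[\cdot,\cdot]$ the matrix commutator. Let $c_1,\dots,c_L$ be the Gauss–Legendre nodes on $[0,1]$ and $p_l(t)=\prod_{i\ne l}(t-c_i)/(c_l-c_i)$. Then $\mathcal Q_h[\mathsf H_k;\mathbf u](x)$ is the $k$-th Magnus term $\mathsf H_k(h)$ in which $\mathsf A(\xi)$ is replaced by $\sum_{l=1}^Lp_l(\xi/h)\,\mathsf A(\mathbf u_l(x),\partial_x\mathbf u_l(x))$; equivalently each iterated integral of a multilinear commutator $\mathcal L(\mathsf A(\xi_1),\dots,\mathsf A(\xi_k))$ is replaced by a weighted sum of $\mathcal L$ evaluated at the nodal matrices. *)

(* Defs.v *)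
From mathcomp Require Import all_boot all_order all_algebra.
From mathcomp Require Import complex polyrcf.
From mathcomp Require Import all_classical all_reals all_analysis.
Set Implicit Arguments.
Unset Strict Implicit.
Unset Printing Implicit Defensive.
Import Order.TTheory GRing.Theory Num.Theory.
Import numFieldNormedType.Exports.
Local Open Scope classical_set_scope.
Local Open Scope ring_scope.

Definition l2norm (R : realType) (n : nat) (v : 'cV[R]_n) : R :=
  Num.sqrt (\sum_(i < n) v i ord0 ^+ 2).

Definition expmx (R : realType) (n : nat) (M : 'M[R]_n.+1) : 'M[R]_n.+1 :=
  lim (series (fun k : nat => (k`!%:R)^-1 *: M ^+ k) @ \oo).

Definition mxcomm (R : realType) (n : nat) (M N : 'M[R]_n) : 'M[R]_n :=
  M *m N - N *m M.

(* Entrywise Lebesgue integral over [0, t]; only meant for 0 <= t. *)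
Definition mxintegral (R : realType) (m n : nat) (F : R -> 'M[R]_(m, n))
    (t : R) : 'M[R]_(m, n) :=
  \matrix_(i, j) \int[lebesgue_measure]_(s in `[0, t]) F s i j.

(* Bernoulli numbers with B_1 = - 1/2, from the recurrence
   \sum_(i < n.+1) 'C(n.+1, i) B_i = 0 for n > 0; [bernoulli_upto R n]
   lists B_0, ..., B_n. *)
Fixpoint bernoulli_upto (R : realType) (n : nat) : seq R :=
  if n is n'.+1 then
    let B := bernoulli_upto R n' in
    rcons B (- (n.+1%:R)^-1 * \sum_(i < n) 'C(n.+1, i)%:R * B`_i)
  else [:: 1].

Definition bernoulli (R : realType) (n : nat) : R := (bernoulli_upto R n)`_n.

Section Magnus.
Variables (R : realType) (n : nat).

(* The Magnus recursion giving the k-th term from the earlier terms [H i],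
   i < k; the inner sum is over the compositions kk of k - 1 into j positive
   parts, and the foldr is the right-nested commutator ending in A s. *)
Definition magnus_step (A : R -> 'M[R]_n) (H : nat -> R -> 'M[R]_n)
    (k : nat) (t : R) : 'M[R]_n :=
  if k == 1%N then mxintegral A t else
  \sum_(1 <= j < k) (bernoulli R j / j`!%:R) *:
    \sum_(kk : j.-tuple 'I_k |
            all (fun i : 'I_k => (0 < i)%N) kk
            && ((\sum_(i <- kk) (i : nat))%N == k.-1))
      mxintegral
        (fun s => foldr (fun (i : 'I_k) M => mxcomm (H i s) M) (A s) kk) t.

Fixpoint magnus_upto (A : R -> 'M[R]_n) (m : nat) : nat -> R -> 'M[R]_n :=
  if m is m'.+1 then
    fun k => if (k <= m')%N then magnus_upto A m' k
             else magnus_step A (magnus_upto A m') k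
  else fun _ _ => 0.

Definition magnus (A : R -> 'M[R]_n) (k : nat) : R -> 'M[R]_n :=
  magnus_upto A k k.

End Magnus.

(* Rodrigues formula; the normalisation is irrelevant to the roots. *)
Definition shifted_legendre (R : realType) (L : nat) : {poly R} :=
  (('X * ('X - 1)) ^+ L)^`(L).

(* [rootsR] lists the real roots in increasing order; the L-th shifted Legendre
   polynomial has L simple roots, all in ]0, 1[. *)
Definition gauss_node (R : realType) (L : nat) (l : 'I_L) : R :=
  (rootsR (shifted_legendre R L))`_l.

Definition lagrange_basis (R : realType) (L : nat) (c : 'I_L -> R) (l : 'I_L)
    (t : R) : R :=
  \prod_(i < L | i != l) ((t - c i) / (c l - c i)).

Definition matA (R : realType) (a b : R[i]) : 'M[R]_3 :=
  let re : R := complex.Re b in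
  let im : R := complex.Im b in
  let q : R := ComplexField.Normc.normc a ^+ 2 / 2 in
  \matrix_(i < 3, j < 3)
    nth 0 (nth [::] [:: [:: 0;    - im; re ];
                        [:: im;   0;    - q];
                        [:: - re; q;    0  ]] i) j.

Definition cderivable (R : realType) (f : R -> R[i]) (x : R) : Prop :=
  derivable (fun y => complex.Re (f y)) x 1 /\
  derivable (fun y => complex.Im (f y)) x 1.

Definition cderive (R : realType) (f : R -> R[i]) (x : R) : R[i] :=
  Complex (derive1 (fun y => complex.Re (f y)) x)
          (derive1 (fun y => complex.Im (f y)) x).

Definition interpA (R : realType) (L : nat) (h : R) (u : R -> 'cV[R[i]]_L)
    (x xi : R) : 'M[R]_3 :=
  \sum_(l < L) lagrange_basis (@gauss_node R L) l (xi / h) *: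
    matA (u x l ord0) (cderive (fun y => u y l ord0) x).

Definition magnus_quad (R : realType) (L : nat) (h : R) (k : nat)
    (u : R -> 'cV[R[i]]_L) (x : R) : 'M[R]_3 :=
  magnus (interpA h u x) k h.

Section Recursions.
Variable R : realType.

Lemma size_bernoulli_upto n : size (bernoulli_upto R n) = n.+1.
Proof. by elim: n => //= n IHn; rewrite size_rcons IHn. Qed.

Lemma nth_bernoulli_upto m k : (k <= m)%N ->
  (bernoulli_upto R m)`_k = bernoulli R k.
Proof.
elim: m => [|m IHm]; first by rewrite leqn0 => /eqP ->.
rewrite leq_eqVlt => /orP[/eqP -> //|km].
by rewrite /= nth_rcons size_bernoulli_upto km IHm.
Qed.

Lemma bernoulliE n :
  \sum_(i < n.+1) 'C(n.+1, i)%:R * bernoulli R i = (n == 0%N)%:R.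
Proof.
case: n => [|n]; first by rewrite big_ord1 bin0 mul1r.
rewrite big_ord_recr /= binSn {2}/bernoulli /=.
rewrite nth_rcons size_bernoulli_upto ltnn eqxx.
rewrite mulrA mulrN divff ?pnatr_eq0// mulN1r.
apply/eqP; rewrite subr_eq0; apply/eqP.
by apply: eq_bigr => i _; rewrite nth_bernoulli_upto// -ltnS.
Qed.

Lemma magnus_uptoE n (A : R -> 'M[R]_n) m k : (0 < k <= m)%N ->
  magnus_upto A m k = magnus A k.
Proof.
elim: m k => [|m IHm] k; first by case: k.
case/andP=> k0; rewrite leq_eqVlt => /orP[/eqP -> //|km] /=.
by rewrite -ltnS km IHm// k0.
Qed.

Lemma magnus1 n (A : R -> 'M[R]_n) : magnus A 1 = mxintegral A.
Proof. by []. Qed.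

Lemma magnusE n (A : R -> 'M[R]_n) k t : (1 < k)%N ->
  magnus A k t =
  \sum_(1 <= j < k) (bernoulli R j / j`!%:R) *:
    \sum_(kk : j.-tuple 'I_k |
            all (fun i : 'I_k => (0 < i)%N) kk
            && ((\sum_(i <- kk) (i : nat))%N == k.-1))
      mxintegral (fun s =>
        foldr (fun (i : 'I_k) M => mxcomm (magnus A i s) M) (A s) kk) t.
Proof.
case: k => // k k1; rewrite /magnus /= ltnn /magnus_step gtn_eqF//.
apply: eq_bigr => j _; congr (_ *: _); apply: eq_bigr => kk /andP[kk0 _].
congr mxintegral; apply/funext => s.
elim: (tval kk) kk0 => //= i s' IHs /andP[i0 s'0].
by rewrite IHs// magnus_uptoE// i0 -ltnS ltn_ord.
Qed.

End Recursions.

(* Main.v *)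
Require Import Defs.
From mathcomp Require Import all_boot all_order all_algebra.
From mathcomp Require Import complex ring.
From mathcomp Require Import all_classical all_reals all_analysis.
Set Implicit Arguments.
Unset Strict Implicit.
Unset Printing Implicit Defensive.
Import Order.TTheory GRing.Theory Num.Theory.
Import numFieldNormedType.Exports.
Local Open Scope ring_scope.

(** The Magnus quadrature is a skew-symmetric matrix, and the exponential of a
    skew-symmetric matrix is orthogonal, hence an isometry for the Euclidean
    norm; linearity reduces the claim on v and w to their difference.

    Skew-symmetry ([trmx_magnus_skew]): each matrix A(a, b) is skew-symmetric,
    and skew-symmetric matrices form a Lie algebra, closed under sums, real
    multiples, entrywise integrals and commutators. The Magnus recursion uses
    no other operation, so skew-symmetry passes through it by strong induction
    on the order of the term. The interpolated coefficient is a combination of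
    matrices A(a, b) with real weights, hence skew-symmetric too.

    Orthogonality ([expmx_skew_orthogonal]): if M is skew-symmetric, the
    transpose of exp(M) is exp(-M), and it remains to see that
    exp(-M) exp(M) = 1 ([expmxNM]). Write e_a for the Taylor polynomial of
    exp(aX) truncated below degree N. The polynomial e_(-1) e_1 - 1 has no
    coefficient below degree N, by the binomial theorem, and each of its
    coefficients is bounded by that of e_1 e_1 - e_2. Evaluating at M, the
    entries of e_(-1)(M) e_1(M) - 1 are therefore, in absolute
    value, at most e_1(c)^2 - e_2(c), where c is the sum of the absolute values of the
    entries of M. That tends to exp(c)^2 - exp(2c) = 0, so the scalar functional
    equation of exp replaces a Cauchy product theorem for matrix series. *)

(** * The Magnus terms of a skew-symmetric matrix function *)

Lemma trmx_mxcomm_skew (R : realType) (n : nat) (M N : 'M[R]_n) :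
  M^T = - M -> N^T = - N -> (mxcomm M N)^T = - mxcomm M N.
Proof.
move=> Ms Ns; rewrite /mxcomm linearB /= !trmx_mul Ms Ns.
by rewrite !mulNmx !mulmxN !opprK opprB.
Qed.

(** This holds even for functions that are not integrable: the integral
    is the difference of the integrals of the positive and negative parts, which
    negation swaps, and when that difference is infinite or of the form oo - oo,
    the real-valued integral is 0 for both functions. *)
Lemma RintegralN_total d (T : measurableType d) (R : realType)
    (mu : {measure set T -> \bar R}) (D : set T) (f : T -> R) :
  Rintegral mu D (fun s => - f s) = - Rintegral mu D f.
Proof.
rewrite /Rintegral integralE [in RHS]integralE.
have -> : (fun s => (- f s)%:E) = (\- (fun s => (f s)%:E))%E by [].
rewrite funeposN funenegN.
by case: (integral mu D _) => [a| |]; case: (integral mu D _) => [b| |] //=;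
  rewrite ?oppr0// opprB.
Qed.

Lemma trmx_mxintegral_skew (R : realType) (n : nat) (F : R -> 'M[R]_n) t :
  (forall s, (F s)^T = - F s) -> (mxintegral F t)^T = - mxintegral F t.
Proof.
move=> Fs; apply/matrixP => i j; rewrite !mxE -RintegralN_total.
congr Rintegral; apply/funext => s.
by have /matrixP/(_ i j) := Fs s; rewrite !mxE.
Qed.

Lemma trmx_sum_skew (R : realType) (n : nat) I (r : seq I) (P : pred I)
    (F : I -> 'M[R]_n) :
  (forall i, P i -> (F i)^T = - F i) ->
  (\sum_(i <- r | P i) F i)^T = - \sum_(i <- r | P i) F i.
Proof.
by move=> Fs; rewrite linear_sum /= -sumrN; apply: eq_bigr => i /Fs.
Qed.

Lemma trmx_scale_skew (R : realType) (n : nat) (a : R) (M : 'M[R]_n) :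
  M^T = - M -> (a *: M)^T = - (a *: M).
Proof. by move=> Ms; rewrite linearZ /= Ms scalerN. Qed.

(** The induction is strong since the recursion for the term of order k nests
    commutators with all the terms of smaller order. *)
Lemma trmx_magnus_skew (R : realType) (n : nat) (A : R -> 'M[R]_n) :
  (forall s, (A s)^T = - A s) ->
  forall k t, (magnus A k t)^T = - magnus A k t.
Proof.
move=> As; elim/ltn_ind => -[|[|k]] IH t.
- by rewrite /magnus /= trmx0 oppr0.
- by rewrite magnus1; exact: trmx_mxintegral_skew.
rewrite magnusE//; apply: trmx_sum_skew => j _; apply: trmx_scale_skew.
apply: trmx_sum_skew => kk _; apply: trmx_mxintegral_skew => s.
elim: (tval kk) => //= i kk' IHkk.
by apply: trmx_mxcomm_skew => //; exact: IH.
Qed.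

Lemma trmx_matA (R : realType) (a b : R[i]) : (matA a b)^T = - matA a b.
Proof.
apply/matrixP => i j; rewrite !mxE.
by case: i => -[|[|[|//]]] ?; case: j => -[|[|[|//]]] ? /=;
  rewrite ?opprK ?oppr0.
Qed.

Lemma trmx_interpA (R : realType) (L : nat) (h : R) (u : R -> 'cV[R[i]]_L)
    (x xi : R) : (interpA h u x xi)^T = - interpA h u x xi.
Proof.
by apply: trmx_sum_skew => l _; apply: trmx_scale_skew; exact: trmx_matA.
Qed.

(** * Entrywise bounds on matrix powers and polynomials *)

(** Any submultiplicative norm dominating the entries would do; this one makes
    the bound on the entries of powers a one-step induction. *)
Definition mxsumnorm (R : realType) (n : nat) (M : 'M[R]_n) : R :=
  \sum_i \sum_j `|M i j|.

Lemma mxsumnorm_ge0 (R : realType) (n : nat) (M : 'M[R]_n) : 0 <= mxsumnorm M.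
Proof. by apply: sumr_ge0 => i _; exact: sumr_ge0. Qed.

Lemma normr_expmx_coord (R : realType) (n : nat) (M : 'M[R]_n.+1) k i j :
  `|(M ^+ k) i j| <= mxsumnorm M ^+ k.
Proof.
elim: k i j => [|k IHk] i j.
  by rewrite !expr0 mxE; case: eqP; rewrite ?normr1 ?normr0 ?ler01.
rewrite !exprS mxE; apply: le_trans (ler_norm_sum _ _ _) _.
apply: (@le_trans _ _ ((\sum_l `|M i l|) * mxsumnorm M ^+ k)).
  rewrite mulr_suml; apply: ler_sum => l _.
  by rewrite normrM ler_wpM2l.
rewrite ler_wpM2r ?exprn_ge0 ?mxsumnorm_ge0//.
rewrite /mxsumnorm [leRHS](bigD1 i)//= lerDl.
by apply: sumr_ge0 => l _; exact: sumr_ge0.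
Qed.

Lemma horner_mx_coef_wide (R : comNzRingType) (n N : nat) (M : 'M[R]_n.+1)
    (p : {poly R}) :
  (size p <= N)%N -> horner_mx M p = \sum_(i < N) p`_i *: M ^+ i.
Proof.
move=> pN; have {1}-> : p = \poly_(i < N) p`_i.
  apply/polyP => i; rewrite coef_poly; case: ltnP => // Ni.
  by rewrite nth_default// (leq_trans pN).
rewrite poly_def rmorph_sum /=; apply: eq_bigr => i _.
by rewrite horner_mxZ rmorphXn /= horner_mx_X.
Qed.

(** Reduces estimates on a polynomial of a matrix to scalar ones: a majorant of
    the coefficients, evaluated at the norm, majorizes the entries. *)
Lemma horner_mx_dominated (R : realType) (n : nat) (M : 'M[R]_n.+1)
    (p q : {poly R}) i j :
  (forall m, `|p`_m| <= q`_m) -> `|horner_mx M p i j| <= q.[mxsumnorm M].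
Proof.
move=> pq; pose N := maxn (size p) (size q).
rewrite (@horner_mx_coef_wide _ _ N) ?leq_maxl// summxE.
rewrite (@horner_coef_wide _ N) ?leq_maxr//.
apply: le_trans (ler_norm_sum _ _ _) _; apply: ler_sum => m _.
by rewrite mxE normrM ler_pM// normr_expmx_coord.
Qed.

(** * Truncated exponential polynomials *)

Definition exp_poly (R : realType) (a : R) (N : nat) : {poly R} :=
  \poly_(i < N) (a ^+ i / i`!%:R).

Lemma horner_exp_poly (R : realType) (a x : R) (N : nat) :
  (exp_poly a N).[x] = series (exp_coeff (a * x)) N.
Proof.
rewrite horner_poly /series /= big_mkord; apply: eq_bigr => i _.
by rewrite /exp_coeff /= exprMn mulrAC.
Qed.

Lemma horner_mx_exp_poly (R : realType) (n : nat) (a : R) (M : 'M[R]_n.+1) N :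
  horner_mx M (exp_poly a N) =
  series (fun k => (k`!%:R)^-1 *: (a *: M) ^+ k) N.
Proof.
rewrite (@horner_mx_coef_wide _ _ N) ?size_poly// /series /= big_mkord.
apply: eq_bigr => i _; rewrite coef_poly ltn_ord exprZn scalerA.
by rewrite [in RHS]mulrC.
Qed.

(** Below the truncation degree the product has the same coefficients as the
    product of the full series, given by the binomial theorem. *)
Lemma coef_exp_polyM (R : realType) (a b : R) (N m : nat) :
  (m < N)%N -> (exp_poly a N * exp_poly b N)`_m = (a + b) ^+ m / m`!%:R.
Proof.
move=> mN; rewrite coefM addrC exprDn mulr_suml; apply: eq_bigr => i _.
have im : (i <= m)%N by rewrite -ltnS ltn_ord.
rewrite !coef_poly (leq_ltn_trans im mN) (leq_ltn_trans (leq_subr i m) mN).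
have fact_neq0 k : k`!%:R != 0 :> R by rewrite pnatr_eq0 -lt0n fact_gt0.
rewrite -(bin_fact im) !natrM -mulr_natr.
have : 'C(m, i)%:R != 0 :> R by rewrite pnatr_eq0 -lt0n bin_gt0.
move: (fact_neq0 i) (fact_neq0 (m - i)%N) => ? ? ?.
by field; apply/and3P; split.
Qed.

(** Both sides vanish below degree N. From degree N on, neither 1 nor the
    truncation of exp(2X) contributes, and the coefficients of the two products
    are sums of the same terms up to sign, all positive on the right. *)
Lemma coef_exp_polyNM_dominated (R : realType) (N m : nat) : (0 < N)%N ->
  `|(exp_poly (- 1) N * exp_poly 1 N - 1)`_m| <=
  (exp_poly 1 N * exp_poly 1 N - exp_poly (1 + 1) N)`_m :> R.
Proof.
move=> N0; rewrite !coefB coef1 [_`_m in leRHS]/=.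
case: (ltnP m N) => [mN|Nm].
  rewrite !coef_exp_polyM// coef_poly mN subrr addNr expr0n.
  by case: m mN => [|m] _; rewrite ?divr1 ?mul0r subrr normr0.
rewrite coef_poly ltnNge Nm /= !subr0 gtn_eqF ?(leq_trans N0)// subr0.
rewrite !coefM; apply: le_trans (ler_norm_sum _ _ _) _.
apply: ler_sum => i _; rewrite !coef_poly.
case: ifP => _; case: ifP => _; rewrite ?mul0r ?mulr0 ?normr0//.
by rewrite !normrM !normfV !normrX normrN1 normr1 !normr_nat.
Qed.

(** * The matrix exponential *)

Local Open Scope classical_set_scope.

Lemma cvg_mx_coord (R : realType) (T : Type) (F : set_system T) (m n : nat)
    (f : T -> 'M[R]_(m, n)) (M : 'M[R]_(m, n)) : Filter F ->
  (forall i j, f x i j @[x --> F] --> M i j) -> f x @[x --> F] --> M.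
Proof.
move=> FF fM A [P MP PA]; have : \forall x \near F, forall ij : 'I_m * 'I_n,
    P ij.1 ij.2 (f x ij.1 ij.2).
  by apply: filter_forall => -[i j]; exact: fM (MP i j).
by apply: filterS => x Px; apply: PA => i j; exact: (Px (i, j)).
Qed.

Lemma cvg_sum_ord (R : realType) (n : nat) (f : 'I_n -> nat -> R)
    (l : 'I_n -> R) :
  (forall i, f i @ \oo --> l i) ->
  (fun N => \sum_i f i N) @ \oo --> \sum_i l i.
Proof.
move=> fl; have -> : (fun N => \sum_i f i N) = \sum_i f i.
  by apply/funext => N; rewrite fct_sumE.
elim/big_ind2 : _ => [|x1 x2 y1 y2 h1 h2|i _]; [exact: cvg_cst|exact: cvgD|].
exact: fl.
Qed.

(** The exponential is defined as a limit of matrices, which is meaningful only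
    once the series is known to converge: entrywise it is dominated by the real
    exponential series at [mxsumnorm M]. *)
Lemma cvg_expmx_coord (R : realType) (n : nat) (M : 'M[R]_n.+1) i j :
  (fun N => series (fun k => (k`!%:R)^-1 *: M ^+ k) N i j) @ \oo
  --> expmx M i j.
Proof.
pose e i j : nat -> R := fun k => (k`!%:R)^-1 * (M ^+ k) i j.
have eE N a b : series (fun k => (k`!%:R)^-1 *: M ^+ k) N a b =
    series (e a b) N.
  by rewrite /series /= summxE; apply: eq_bigr => k _; rewrite mxE.
have e_cvg a b : cvgn (series (e a b)).
  apply: normed_cvg.
  apply: series_le_cvg (is_cvg_series_exp_coeff (mxsumnorm M)) => k //.
  - exact: normr_ge0.
  - by rewrite /exp_coeff /= divr_ge0 ?exprn_ge0 ?mxsumnorm_ge0.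
  - rewrite /e /exp_coeff /= normrM normfV normr_nat mulrC ler_wpM2r//.
    exact: normr_expmx_coord.
have sM : series (fun k => (k`!%:R)^-1 *: M ^+ k) @ \oo -->
    \matrix_(a, b) limn (series (e a b)).
  apply: cvg_mx_coord => a b; rewrite mxE.
  under eq_fun do rewrite eE.
  exact: e_cvg.
have -> : expmx M = \matrix_(a, b) limn (series (e a b)).
  exact: cvg_lim sM.
rewrite mxE; under eq_fun do rewrite eE.
exact: e_cvg.
Qed.

Lemma cvg_mulmx_coord (R : realType) (m n p : nat)
    (f : nat -> 'M[R]_(m, n)) (g : nat -> 'M[R]_(n, p))
    (A : 'M[R]_(m, n)) (B : 'M[R]_(n, p)) i j :
  (forall i j, (fun N => f N i j) @ \oo --> A i j) ->
  (forall i j, (fun N => g N i j) @ \oo --> B i j) ->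
  (fun N => (f N *m g N) i j) @ \oo --> (A *m B) i j.
Proof.
move=> fA gB; rewrite mxE; under eq_fun do rewrite mxE.
by apply: cvg_sum_ord => k; apply: cvgM.
Qed.

(** The error of the product of partial sums is squeezed between 0 and the
    scalar quantity [r], whose limit is exp(c)^2 - exp(2c) = 0. *)
Lemma expmxNM (R : realType) (n : nat) (M : 'M[R]_n.+1) :
  expmx (- M) *m expmx M = 1%:M.
Proof.
apply/matrixP => i j.
pose c := mxsumnorm M.
pose P a N : 'M[R]_n.+1 := horner_mx M (exp_poly a N).
have P_cvg a k l : (fun N => P a N k l) @ \oo --> expmx (a *: M) k l.
  rewrite /P; under eq_fun do rewrite horner_mx_exp_poly.
  exact: cvg_expmx_coord.
have prod_cvg : (fun N => (P (- 1) N *m P 1 N) i j) @ \oo -->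
    (expmx (- M) *m expmx M) i j.
  apply: cvg_mulmx_coord => k l.
    by have := P_cvg (- 1) k l; rewrite scaleN1r.
  by have := P_cvg 1 k l; rewrite scale1r.
pose r N : R := (exp_poly 1 N * exp_poly 1 N - exp_poly (1 + 1) N).[c].
have r_cvg0 : r @ \oo --> (0 : R).
  have -> : 0 = expR c * expR c - expR ((1 + 1) * c) :> R.
    by rewrite -expRD mulrDl mul1r subrr.
  have -> : r = (fun N => series (exp_coeff c) N * series (exp_coeff c) N
      - series (exp_coeff ((1 + 1) * c)) N).
    apply/funext => N.
    by rewrite /r hornerD hornerN hornerM !horner_exp_poly mul1r.
  by apply: cvgB; [apply: cvgM|]; exact: is_cvg_series_exp_coeff.
suff prod_cvg1 : (fun N => (P (- 1) N *m P 1 N) i j) @ \oo -->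
    (1%:M : 'M[R]_n.+1) i j.
  exact: cvg_unique prod_cvg prod_cvg1.
apply/cvgrPdist_le => e e0.
move/cvgrPdist_le : r_cvg0 => /(_ _ e0).
apply: filter_app; near=> N.
rewrite sub0r normrN => /(le_trans (ler_norm _)); apply: le_trans.
rewrite distrC.
have -> : (P (- 1) N *m P 1 N) i j - (1%:M : 'M[R]_n.+1) i j =
    horner_mx M (exp_poly (- 1) N * exp_poly 1 N - 1) i j.
  by rewrite rmorphB rmorphM (rmorph1 (horner_mx M)) !mxE.
apply: horner_mx_dominated => m; apply: coef_exp_polyNM_dominated.
near: N; exact: nbhs_infty_gt.
Unshelve. all: by end_near.
Qed.

Lemma trmx_exp (R : comNzRingType) (n k : nat) (M : 'M[R]_n.+1) :
  (M ^+ k)^T = M^T ^+ k.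
Proof.
by elim: k => [|k IHk]; rewrite ?trmx1// exprS exprSr trmx_mul IHk.
Qed.

Lemma trmx_expmx (R : realType) (n : nat) (M : 'M[R]_n.+1) :
  (expmx M)^T = expmx M^T.
Proof.
apply/matrixP => i j; rewrite mxE.
have lim_tr : (fun N => series (fun k => (k`!%:R)^-1 *: M ^+ k) N j i) @ \oo
    --> expmx M^T i j.
  suff -> : (fun N => series (fun k => (k`!%:R)^-1 *: M ^+ k) N j i) =
      (fun N => series (fun k => (k`!%:R)^-1 *: M^T ^+ k) N i j).
    exact: cvg_expmx_coord.
  apply/funext => N; rewrite /series /= !summxE; apply: eq_bigr => k _.
  by rewrite -trmx_exp !mxE.
have lim_M := @cvg_expmx_coord R n M j i.
exact: cvg_unique lim_M lim_tr.
Qed.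

Lemma expmx_skew_orthogonal (R : realType) (n : nat) (M : 'M[R]_n.+1) :
  M^T = - M -> (expmx M)^T *m expmx M = 1%:M.
Proof. by move=> Ms; rewrite trmx_expmx Ms expmxNM. Qed.

Local Close Scope classical_set_scope.

(** * Isometry *)

Lemma l2norm_orthogonal (R : realType) (n : nat) (Q : 'M[R]_n) (v : 'cV[R]_n) :
  Q^T *m Q = 1%:M -> l2norm (Q *m v) = l2norm v.
Proof.
have sqE (z : 'cV[R]_n) : \sum_(i < n) z i ord0 ^+ 2 = (z^T *m z) ord0 ord0.
  by rewrite mxE; apply: eq_bigr => i _; rewrite mxE expr2.
by move=> QQ; rewrite /l2norm !sqE trmx_mul mulmxA -(mulmxA v^T) QQ mulmx1.
Qed.

Theorem proposition3p9 (R : realType) (p L : nat) (h T : R)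
    (hp : (1 <= p)%N) (hL : L = uphalf p.+1) (hh : 0 < h) (hT : 0 < T)
    (v w : R -> R -> 'cV[R]_3)
    (hv : forall t, 0 <= t <= T -> periodic (v t) (2 * pi))
    (hw : forall t, 0 <= t <= T -> periodic (w t) (2 * pi))
    (u : R -> 'cV[R[i]]_L)
    (hu : periodic u (2 * pi))
    (hu' : forall (l : 'I_L) (x : R), cderivable (fun y => u y l ord0) x)
    (t x : R) (ht : 0 <= t <= T) :
  let E := expmx (\sum_(1 <= k < p.+1) magnus_quad h k u x) in
  l2norm (E *m v t x - E *m w t x) = l2norm (v t x - w t x).
Proof.
move=> E; rewrite -mulmxBr; apply: l2norm_orthogonal.
apply: expmx_skew_orthogonal; apply: trmx_sum_skew => k _.
by apply: trmx_magnus_skew => s; exact: trmx_interpA.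
Qed.
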